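(* For a prime $p$, let $W_p$ be the $\mathbb{F}_p$-vector space of all sequences $(\bar C_n)_{n\ge 0}$ with $\bar C_n\in\mathbb{F}_p$ satisfying, for all $n\ge 0$, $$4(n+4)\bar C_{n+5}+8(n+2)\bar C_{n+4}+(n+3)\bar C_{n+3}+(4n+7)\bar C_{n+2}+(5n+4)\bar C_{n+1}+2n\,\bar C_n=0$$ (coefficients read in $\mathbb{F}_p$), and let $V_p\subseteq\mathbb{F}_p^4$ be the image of $W_p$ under $(\bar C_n)\mapsto(\bar C_1,\bar C_2,\bar C_3,\bar C_4)$. Then $W_p$ is infinite-dimensional over $\mathbb{F}_p$. Moreover, for every prime $p\notin\{2,3,5,13\}$: $\dim V_p=2$; $V_p$ is contained in the hyperplane $6\bar C_4+\bar C_2+\bar C_1=0$; and $V_p$ is spanned by the reduction modulo $p$ of $(1,2,-\tfrac18,-\tfrac12)$ and by the reduction modulo $p$ of $(c_{p+1},c_{p+2},c_{p+3},c_{p+4})$.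
   Context: Here $(c_n)_{n\ge0}$ is the unique sequence of rational numbers satisfying the same recurrence (over $\mathbb{Q}$) with $c_0=0,\ c_1=1,\ c_2=2,\ c_3=-\tfrac18,\ c_4=-\tfrac12$; all $c_n$ have denominators that are powers of $2$, so their reductions modulo an odd prime $p$ make sense. *)

(* Defs.v *)
From HB Require Import structures.
From mathcomp Require Import all_boot all_order all_algebra.
From mathcomp Require Import boolp classical_sets functions.
From mathcomp Require Import ring.

Set Implicit Arguments.
Unset Strict Implicit.
Unset Printing Implicit Defensive.

Import Order.TTheory GRing.Theory Num.Theory.
Local Open Scope ring_scope.

Definition recurrence (R : pzRingType) (u : nat -> R) : Prop :=
  forall n : nat,
    (4 * (n + 4))%N%:R * u (n + 5)%N + (8 * (n + 2))%N%:R * u (n + 4)%N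
    + (n + 3)%N%:R * u (n + 3)%N + (4 * n + 7)%N%:R * u (n + 2)%N
    + (5 * n + 4)%N%:R * u (n + 1)%N + (2 * n)%N%:R * u n = 0.

(* The window [:: c_n; c_(n+1); c_(n+2); c_(n+3); c_(n+4)]; the new last entry
   is obtained by solving the recurrence over rat for its leading term. *)
Fixpoint c_window (n : nat) : seq rat :=
  if n is m.+1 then
    let s := c_window m in
    rcons (behead s)
      (- ((8 * (m + 2))%N%:R * s`_4 + (m + 3)%N%:R * s`_3
          + (4 * m + 7)%N%:R * s`_2 + (5 * m + 4)%N%:R * s`_1
          + (2 * m)%N%:R * s`_0) / (4 * (m + 4))%N%:R)
  else [:: 0; 1; 2; - (1 / 8); - (1 / 2)].

Definition c (n : nat) : rat := (c_window n)`_0.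

Definition c_spec (u : nat -> rat) : Prop :=
  [/\ recurrence u, u 0%N = 0, u 1%N = 1, u 2%N = 2 &
      u 3%N = - (1 / 8) /\ u 4%N = - (1 / 2)].

Lemma c_windowE n : c_window n = [:: c n; c n.+1; c n.+2; c n.+3; c n.+4].
Proof.
have [a0 [a1 [a2 [a3 [a4 E]]]]] : exists a0 a1 a2 a3 a4,
    c_window n = [:: a0; a1; a2; a3; a4].
  elim: n => [|n [a0 [a1 [a2 [a3 [a4 E]]]]]]; first by do 5!eexists.
  by rewrite [c_window n.+1]/= E /=; do 5!eexists.
by rewrite /c [c_window n.+4]/= [c_window n.+3]/= [c_window n.+2]/=
  [c_window n.+1]/= E.
Qed.

Lemma c_next n : c n.+4.+1 =
  - ((8 * (n + 2))%N%:R * c n.+4 + (n + 3)%N%:R * c n.+3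
      + (4 * n + 7)%N%:R * c n.+2 + (5 * n + 4)%N%:R * c n.+1
      + (2 * n)%N%:R * c n) / (4 * (n + 4))%N%:R.
Proof.
have := c_windowE n.+1; rewrite [c_window n.+1]/= (c_windowE n) /= => -[<-].
by [].
Qed.

Lemma c_specP (u : nat -> rat) : c_spec u <-> u = c.
Proof.
have nz n : (4 * (n + 4))%N%:R != 0 :> rat.
  by rewrite pnatr_eq0 muln_eq0 addn_eq0 andbF.
split=> [[hu u0 u1 u2 [u3 u4]]|->]; last first.
  split=> // n; rewrite !(addnC n) /= c_next !(addnC n).
  have := nz n; rewrite addnC; set d := (4 * (4 + n))%N%:R => dn0.
  by rewrite mulrC divfK //; ring.
apply/funext => n.
suff [] : [/\ u n = c n, u n.+1 = c n.+1, u n.+2 = c n.+2 &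
              u n.+3 = c n.+3 /\ u n.+4 = c n.+4] by [].
elim: n => [|n [e0 e1 e2 [e3 e4]]]; first by rewrite u0 u1 u2 u3 u4.
split=> //; split=> //; apply: (mulfI (nz n)).
rewrite c_next -e0 -e1 -e2 -e3 -e4 [RHS]mulrC divfK //.
have := hu n; rewrite (addnC n 5) (addnC n 1) !add1n.
have -> : (n + 2 = n.+2)%N by rewrite addnC.
have -> : (n + 3 = n.+3)%N by rewrite addnC.
have -> : (n + 4 = n.+4)%N by rewrite addnC.
by move=> E; apply/eqP; rewrite -addr_eq0 !addrA E.
Qed.

Definition finite_dimensional (F : fieldType) (E : lmodType F) (A : set E) :
    Prop :=
  exists (d : nat) (e : 'I_d -> E),
    (forall i, A (e i)) /\
    (forall v, A v -> exists a : 'I_d -> F, v = \sum_(i < d) a i *: e i).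

(* ('F_p)^o is 'F_p seen as a vector space over itself; it gives sequences their
   pointwise vector space structure. *)
Definition W (p : nat) : set (nat -> ('F_p)^o) :=
  [set C | recurrence (C : nat -> 'F_p)]%classic.
Arguments W p _ : clear implicits.

Lemma W_submod (p : nat) :
  W p 0 /\ forall (a : 'F_p) (C D : nat -> ('F_p)^o),
    W p C -> W p D -> W p (a *: C + D).
Proof.
split=> [n|a C D hC hD n]; first by rewrite !mulr0 !addr0.
have -> : 0 = a * 0 + 0 :> 'F_p by rewrite mulr0 addr0.
rewrite -{1}(hC n) -(hD n).
rewrite -![(a *: C + D) _]/(a * (C _ : 'F_p) + (D _ : 'F_p)) /=.
ring.
Qed.

Definition coords14 (p : nat) (C : nat -> ('F_p)^o) : 'rV['F_p]_4 :=
  \row_(i < 4) C i.+1.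

(* The image of W p under coords14, packaged as a subspace: the span adds
   nothing to the image, see V_P. *)
Definition V (p : nat) : {vspace 'rV['F_p]_4} :=
  <<[seq v <- enum 'rV['F_p]_4 |
      `[< (@coords14 p @` W p)%classic v >]]>>%VS.

Lemma V_P (p : nat) (v : 'rV['F_p]_4) :
  v \in V p <-> exists2 C : nat -> ('F_p)^o, W p C & coords14 C = v.
Proof.
have [W0 WS] := W_submod p.
split=> [|hv]; last first.
  case: hv => C hC <-; apply: memv_span.
  rewrite mem_filter mem_enum; apply/andP; split=> //.
  by apply/asboolP; exists C.
rewrite /V; set X := filter _ _; move=> /(@coord_span _ _ _ (in_tuple X)).
move=> ->; apply: (big_ind (fun w => exists2 C, W p C & coords14 C = w)).
- by exists 0 => //; apply/rowP => i; rewrite !mxE.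
- move=> _ _ [C hC <-] [D hD <-]; exists (1 *: C + D); first exact: WS.
  by apply/rowP => i; rewrite !mxE scale1r.
- move=> i _; have : (in_tuple X)`_i \in X by apply: mem_nth.
  rewrite mem_filter => /andP[/asboolP[C hC <-] _].
  exists (coord (in_tuple X) i v *: C + 0); first exact: WS.
  by apply/rowP => j; rewrite !mxE addr0.
Qed.

(* For a rational x, ratr x : 'F_p is numq x / denq x, i.e. the reduction of x
   modulo p whenever p does not divide denq x. *)
Definition red (p m : nat) (x : 'rV[rat]_m) : 'rV['F_p]_m := map_mx ratr x.
Arguments red p {m} x.

Definition row4 (R : Type) (x1 x2 x3 x4 : R) : 'rV[R]_4 :=
  \row_(i < 4) tnth [tuple x1; x2; x3; x4] i.

(* Main.v *)
Require Import Defs.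
From mathcomp Require Import all_boot all_order all_algebra.
From mathcomp Require Import boolp classical_sets functions.
From mathcomp Require Import ring zify.
Set Implicit Arguments.
Unset Strict Implicit.
Unset Printing Implicit Defensive.
Import Order.TTheory GRing.Theory Num.Theory.
Local Open Scope ring_scope.

(* Put s = x^2 + x, t = 2x + 1, q = s^2 + 4 and Q = 4 + 16x + x^3 + x^4.  For
   n >= 0 the recurrence expresses that the coefficient of x^(n+5) in
   L y = t q x y' - Q y vanishes, where y is the generating function.  So y
   solves L y = r, where r ("residual", up to a factor x^2) has degree at most
   4; C_0 never matters and is set to 0.  The equation L y = 0 has the solution
   2 x t q^(-1/2), whose coefficients are the c_n; the binomial series shows
   that they lie in Z[1/2].

   Over F_p with p odd, x t q^((p-1)/2) solves L y = 0, as do its multiples by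
   powers of x^p (for p = 2 take 1 + x), hence W_p is infinite.  Multiplying
   L y = r by the integrating factor x^(p-1) t^(p-2) q^((p-1)/2) gives x times
   a derivative, so (r / x^2) t^(p-2) q^((p-1)/2) has no coefficient in degrees
   congruent to -1 mod p, i.e. is a derivative.  This survives the substitution
   of (x-1)/2 for x, which makes 16 q an even polynomial; the coefficients of
   degrees p-1 and 2p-1 then give two independent linear conditions on r.
   Their solution line is spanned by the residual of (c_(n+p)).  Indeed, were
   that residual zero, the truncation of sum c_n x^n at degree p would be a
   polynomial solution of L y = 0 of degree at most p, but such a solution is
   divisible by q^((p-1)/2). *)

(** * The differential operator L and the residual of a sequence *)

Section Operator.
Variable R : comNzRingType.
Implicit Types Y Z : {poly R}.

Definition tpol : {poly R} := 2%:R * 'X + 1.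
Definition spol : {poly R} := 'X^2 + 'X.
Definition qpol : {poly R} := spol ^+ 2 + 4%:R.
Definition Qpol : {poly R} := 4%:R + 16%:R * 'X + 'X^3 + 'X^4.
Definition recop Y : {poly R} := tpol * qpol * ('X * Y^`()) - Qpol * Y.

Lemma recopB Y Z : recop (Y - Z) = recop Y - recop Z.
Proof. by rewrite /recop derivB; ring. Qed.

Lemma coefXderiv Y m : ('X * Y^`())`_m = Y`_m *+ m.
Proof. by case: m => [|m]; rewrite coefXM ?mulr0n //= coef_deriv. Qed.

Lemma recopE Y (Z := 'X * Y^`()) : recop Y =
  (Z *+ 4 - Y *+ 4) + (Z *+ 8 - Y *+ 16) * 'X^1 + Z * 'X^2
  + (Z *+ 4 - Y) * 'X^3 + (Z *+ 5 - Y) * 'X^4 + (Z *+ 2) * 'X^5.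
Proof.
by rewrite /recop -/Z /tpol /qpol /spol /Qpol; ring.
Qed.

Lemma coef_recop Y n : (recop Y)`_n.+4.+1 =
  (4 * (n + 4))%N%:R * Y`_(n + 5)%N + (8 * (n + 2))%N%:R * Y`_(n + 4)%N
    + (n + 3)%N%:R * Y`_(n + 3)%N + (4 * n + 7)%N%:R * Y`_(n + 2)%N
    + (5 * n + 4)%N%:R * Y`_(n + 1)%N + (2 * n)%N%:R * Y`_n.
Proof.
rewrite recopE !(coefD, coefN, coefMn, coefMXn, coefXderiv) !(ltnS, ltn0).
rewrite !subSS !subn0 !(addnC n) !add1n !add2n !add3n.
rewrite -[(4 + n)%N]/(n.+4) -[(5 + n)%N]/(n.+4.+1).
ring.
Qed.

Lemma coef_recop_low Y : Y`_0 = 0 ->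
  [/\ (recop Y)`_0 = 0, (recop Y)`_1 = 0,
      (recop Y)`_2 = 4%:R * Y`_2 - 8%:R * Y`_1,
      (recop Y)`_3 = 8%:R * Y`_3 + Y`_1 &
      (recop Y)`_4 = 12%:R * Y`_4 + 8%:R * Y`_3 + 2%:R * Y`_2 + 3%:R * Y`_1].
Proof.
move=> Y0.
by split; rewrite recopE !(coefD, coefN, coefMn, coefMXn, coefXderiv)
  !(ltnS, ltn0, leq0n, subSS, subn0) ?Y0; ring.
Qed.

Lemma recop_recurrence Y : recop Y = 0 -> recurrence (fun n => Y`_n).
Proof. by move=> LY n; rewrite -coef_recop LY coef0. Qed.

(** Putting 0 at index 0 respects the recurrence, where [u 0] occurs only with the coefficient 2n at
    n = 0, and clears [u 0] from the coefficients of L y of degree below 5. *)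
Definition seqpol (u : nat -> R) N : {poly R} :=
  \poly_(i < N) (if i is 0%N then 0 else u i).

Definition residual (u : nat -> R) : {poly R} :=
  (4%:R * u 2%N - 8%:R * u 1%N)%:P + (8%:R * u 3%N + u 1%N)%:P * 'X
  + (12%:R * u 4%N + 8%:R * u 3%N + 2%:R * u 2%N + 3%:R * u 1%N)%:P * 'X^2.

(** The coefficient of x^m in L y involves y only up to degree m, so truncation at N is invisible
    below N. Degrees 2 to 4 give the residual, higher degrees the recurrence. *)
Lemma coef_recop_seqpol u N m : recurrence u -> (5 <= N)%N -> (m < N)%N ->
  (recop (seqpol u N))`_m = ('X^2 * residual u)`_m.
Proof.
move=> ru N5 mN.
have Y0 : (seqpol u N)`_0 = 0 by rewrite coef_poly if_same.
have [L0 L1 L2 L3 L4] := coef_recop_low Y0.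
have YE k : (0 < k < N)%N -> (seqpol u N)`_k = u k.
  by case: k => // k /= kN; rewrite coef_poly kN.
rewrite [RHS]coefXnM !(coefD (_ + _)) !(coefD (_%:P)) !coefMXn !coefMX !coefC.
case: m mN => [|[|[|[|[|n]]]]] mN.
- by rewrite L0.
- by rewrite L1.
- by rewrite L2 !YE ?(leq_trans _ N5) //=; ring.
- by rewrite L3 !YE ?(leq_trans _ N5) //=; ring.
- by rewrite L4 !YE ?(leq_trans _ N5) //=; ring.
rewrite coef_recop /= !addr0.
have := ru n; rewrite !(YE (n + _)%N); try lia.
case: n mN => [|n] mN; last by rewrite YE //; lia.
by rewrite muln0 !mul0r.
Qed.

Lemma size_recop Y : (size (recop Y) <= size Y + 5)%N.
Proof.
apply/leq_sizeP => m hm; rewrite recopE.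
rewrite !(coefD, coefN, coefMn, coefMXn, coefXderiv).
have Y0 k : (size Y <= k)%N -> Y`_k = 0 by move=> ?; rewrite nth_default.
rewrite !Y0; try lia.
by rewrite !(mul0rn, oppr0, addr0, if_same).
Qed.

End Operator.

(** * Polynomial solutions in characteristic p and infinite dimension *)

Section CharP.
Variables (F : fieldType) (p : nat).
Hypothesis pcharFp : p \in [pchar F].
Implicit Types (Y : {poly F}).

Local Notation tp := (tpol F).
Local Notation sp := (spol F).
Local Notation qp := (qpol F).
Local Notation half := (p.-1./2).

Let p_pr : prime p := pcharf_prime pcharFp.

Lemma deriv_tpol (R : comNzRingType) : (tpol R)^`() = 2%:R.
Proof. by rewrite /tpol !derivE; ring. Qed.

Lemma deriv_spol (R : comNzRingType) : (spol R)^`() = tpol R.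
Proof. by rewrite /spol /tpol !derivE; ring. Qed.

Lemma deriv_qpol (R : comNzRingType) : (qpol R)^`() = 2%:R * spol R * tpol R.
Proof. by rewrite /qpol /spol /tpol !derivE; ring. Qed.

Lemma mul_deriv_exp (R : comNzRingType) (f : {poly R}) n :
  f * (f ^+ n)^`() = n%:R * f^`() * f ^+ n.
Proof.
case: n => [|n]; first by rewrite expr0 derivC; ring.
by rewrite deriv_exp /= exprS; ring.
Qed.

Lemma natr_p_poly : p%:R = 0 :> {poly F}.
Proof. by rewrite -polyC_natr (pcharf0 pcharFp). Qed.

Lemma recop_mulXpn k Y : recop ('X^(k * p) * Y) = 'X^(k * p) * recop Y.
Proof.
have X0 : ('X^(k * p) : {poly F})^`() = 0.
  by rewrite derivXn -mulr_natr natrM natr_p_poly !mulr0.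
by rewrite /recop derivM X0; ring.
Qed.

Lemma size_qpol_exp n : size (qp ^+ n) = (4 * n).+1.
Proof.
have -> : qp = 'X^4 + (2%:R * 'X^3 + 'X^2 + 4%:R) by rewrite /qpol /spol; ring.
set g := (_ + 4%:R).
have q5 : size ('X^4 + g) = 5%N.
  rewrite size_polyDl size_polyXn // ltnS; apply/leq_sizeP => m m4.
  rewrite /g mulr_natl !(coefD, coefMn, coefXn, coef1).
  by case: m m4 => [|[|[|[|m]]]] // _; rewrite /= ?(mul0rn, addr0).
have := size_exp ('X^4 + g) n; rewrite q5 => <-.
rewrite prednK // lt0n size_poly_eq0.
by rewrite expf_neq0 // -size_poly_eq0 q5.
Qed.

Hypothesis p_odd : odd p.

(** In characteristic p the exponent (p-1)/2 acts as -1/2. *)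
Lemma natr_half : (half%:R : F) *+ 2 = -1.
Proof.
have pE : (half * 2).+1 = p by have := prime_gt1 p_pr; lia.
apply/eqP; rewrite -subr_eq0 opprK -[_ *+ 2]mulr_natr -natrM natr1 pE.
by rewrite (pcharf0 pcharFp).
Qed.

Lemma natrp_half : (half%:R : {poly F}) *+ 2 = -1.
Proof. by rewrite -polyC_natr -polyCMn natr_half polyCN. Qed.

(** This is the equation q h' = -(1/2) q' h of h = q^(-1/2), since q' = 2 s t. *)
Lemma deriv_qpol_half : qp * (qp ^+ half)^`() = - (sp * tp * qp ^+ half).
Proof.
rewrite mul_deriv_exp deriv_qpol.
have := natrp_half; set c := half%:R => c2.
have -> : c * (2%:R * sp * tp) * qp ^+ half = (c *+ 2) * (sp * tp * qp ^+ half).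
  by ring.
by rewrite c2 mulN1r.
Qed.

(* Up to the factor 2 / (s^2 + 4)^(p / 2), whose derivative is zero, this is
   the reduction of 2 x (2 x + 1) (s^2 + 4)^(-1/2). *)
Lemma recop_solution : recop ('X * tp * qp ^+ half) = 0.
Proof.
rewrite /recop !derivM derivX deriv_tpol.
have := deriv_qpol_half; set h := qp ^+ _; set h' := h^`() => E.
have -> : tp * qp * ('X * ((1 * tp + 'X * 2%:R) * h + 'X * tp * h')) =
  tp * 'X * (qp * (tp + 'X * 2%:R) * h + 'X * tp * (qp * h')) by ring.
by rewrite E /qpol /Qpol /tpol /spol; ring.
Qed.

End CharP.

(* A finite-dimensional space over 'F_p is finite, whereas multiplication by
   the powers of x^p yields infinitely many solutions from a single one. *)
Lemma infinite_W (p : nat) (Y : {poly 'F_p}) : prime p ->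
  recop Y = 0 -> Y != 0 -> ~ finite_dimensional (W p).
Proof.
move=> p_pr LY Y0 [d [e [We spanW]]].
have pcharp : p \in [pchar 'F_p] by exact: pchar_Fp.
pose f k : nat -> ('F_p)^o := fun n => ('X^(k * p) * Y)`_n.
have Wf k : W p (f k).
  by apply: recop_recurrence; rewrite recop_mulXpn // LY mulr0.
have f_inj : injective f.
  (* The size of a long enough truncation of [f k] is k p plus the size of Y, which recovers k. *)
  move=> j k /(congr1 (fun g : nat -> ('F_p)^o =>
    size (\poly_(i < (j + k) * p + size Y) (g i : 'F_p)))).
  have sz i : (i <= j + k)%N ->
      size (\poly_(n < (j + k) * p + size Y) (f i n : 'F_p))
      = (i * p + size Y)%N.
    move=> ijk.
    have -> : \poly_(n < (j + k) * p + size Y) (f i n : 'F_p) = 'X^(i * p) * Y.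
      apply/polyP => n; rewrite coef_poly; case: ltnP => // nN.
      rewrite nth_default // mulrC size_mulXn // (leq_trans _ nN) //.
      by rewrite leq_add2r leq_mul2r ijk orbT.
    by rewrite mulrC size_mulXn.
  rewrite !sz ?leq_addl ?leq_addr // => /addIn /eqP.
  by rewrite eqn_pmul2r ?prime_gt0 // => /eqP.
have [a fE] := choice (fun k => spanW (f k) (Wf k)).
(* Pigeonhole: there is one more index than there are coefficient vectors over the finite field. *)
pose g (k : 'I_#|{ffun 'I_d -> 'F_p}|.+1) := [ffun i => a k i].
have g_inj : injective g.
  move=> j k /ffunP E; apply/val_inj/f_inj; rewrite !fE.
  by apply: eq_bigr => i _; have := E i; rewrite !ffunE => ->.
by have := leq_card g g_inj; rewrite card_ord ltnn.
Qed.

Lemma not_finite_dimensional_W (p : nat) :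
  prime p -> ~ finite_dimensional (W p).
Proof.
move=> p_pr; have pcharp : p \in [pchar 'F_p] by exact: pchar_Fp.
case: (even_prime p_pr) => [p2|p_odd]; last first.
  apply: infinite_W (recop_solution pcharp p_odd) _ => //.
  have t0 : tpol 'F_p != 0.
    apply/eqP => /polyP /(_ 0%N); rewrite /tpol mulrC mulr_natr.
    rewrite coefD coefMn coefX coef1 coef0.
    by rewrite mul0rn add0r => /eqP; rewrite oner_eq0.
  rewrite !mulf_neq0 ?polyX_eq0 // -size_poly_eq0.
  by rewrite size_qpol_exp.
subst p; apply: (@infinite_W _ (1 + 'X)) => //; last first.
  by rewrite addrC -size_poly_eq0 -[1]opprK -polyCN size_XsubC.
have E2 : 2%:R = 0 :> {poly 'F_2} by rewrite (natr_p_poly pcharp).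
rewrite /recop /Qpol /qpol /tpol /spol !derivE.
(* Already over the integers, L (1 + x) is twice this polynomial. *)
transitivity (2%:R *
  ('X^6 + 2%:R * 'X^5 + 'X^4 - 4%:R * 'X^2 - 8%:R * 'X - 2%:R)
  : {poly 'F_2}); last by rewrite E2 mul0r.
ring.
Qed.

(** * Linear relations between the coefficients of a residual *)

(* Substituting (x - 1) / 2 for x turns 16 q into kpol 1 evaluated at x^2. *)
Definition kpol (R : comNzRingType) n : {poly R} :=
  ('X^2 - 2%:R * 'X + 65%:R) ^+ n.

Section Functional.
Variables (F : fieldType) (p : nat).
Hypotheses (pcharFp : p \in [pchar F]) (p_odd : odd p).

Local Notation tp := (tpol F).
Local Notation sp := (spol F).
Local Notation qp := (qpol F).
Local Notation half := (p.-1./2).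

Let p_pr : prime p := pcharf_prime pcharFp.
Let p_gt2 : (2 < p)%N.
Proof. by have := prime_gt1 p_pr; lia. Qed.

Lemma coef_eq_mul (R : comNzRingType) (w f g : {poly R}) N m :
  (forall i, (i < N)%N -> f`_i = g`_i) -> (m < N)%N -> (w * f)`_m = (w * g)`_m.
Proof.
move=> fg mN; rewrite !coefM; apply: eq_bigr => i _.
by rewrite fg // (leq_ltn_trans _ mN) // leq_subr.
Qed.

Lemma mulXderiv_Xp1 : 'X * ('X^(p.-1))^`() = - 'X^(p.-1) :> {poly F}.
Proof.
rewrite mul_deriv_exp derivX mulr1 -subn1 natrB ?prime_gt0 //.
by rewrite (natr_p_poly pcharFp) sub0r mulN1r.
Qed.

Lemma mul_deriv_tpol : tp * (tp ^+ (p - 2))^`() = - (4%:R * tp ^+ (p - 2)).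
Proof.
rewrite mul_deriv_exp deriv_tpol natrB ?prime_gt1 // (natr_p_poly pcharFp).
ring.
Qed.

(* x^(p-1) t^(p-2) q^((p-1)/2) is an integrating factor because, modulo
   factors with zero derivative, it is 1 / (x t^2 q^(1/2)). *)
Lemma integrating_factor (Y : {poly F}) :
  let w := 'X^(p.-1) * tp ^+ (p - 2) * qp ^+ half in
  w * recop Y = 'X * (w * tp * qp * Y)^`().
Proof.
move=> w; rewrite /w !derivM deriv_tpol deriv_qpol.
have := deriv_qpol_half pcharFp p_odd; have := mul_deriv_tpol.
have := mulXderiv_Xp1.
set h := qp ^+ _; set h' := h^`(); set B := tp ^+ _; set B' := B^`().
set A := 'X^(p.-1); set A' := A^`() => EA EB Eh.
set rhs := RHS.
have -> : rhs = ('X * A') * (B * h * tp * qp * Y)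
    + 'X * A * h * qp * Y * (tp * B') + 'X * A * B * tp * Y * (qp * h')
    + 'X * A * B * h * Y * (2%:R * qp + tp * (2%:R * sp * tp))
    + 'X * A * B * h * tp * qp * Y^`() by rewrite /rhs; ring.
by rewrite EA EB Eh /recop /Qpol /qpol /tpol /spol; ring.
Qed.

(** The coefficients of x g' in degrees divisible by p vanish. Removing x^(p+1), made of x^(p-1)
    from the integrating factor and x^2 from L y, turns degree (k+2)p into kp + p-1. *)
Lemma coef_residual_eq0 (u : nat -> F) k : recurrence u ->
  (residual u * tp ^+ (p - 2) * qp ^+ half)`_(k * p + p.-1) = 0.
Proof.
move=> ru; set w := 'X^(p.-1) * tp ^+ (p - 2) * qp ^+ half.
pose N := ((k + 2) * p).+1.
have p0 := prime_gt0 p_pr.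
have coef_w : (w * recop (seqpol u N))`_((k + 2) * p) = 0.
  rewrite integrating_factor coefXderiv -mulr_natr natrM (pcharf0 pcharFp).
  by rewrite !mulr0.
move: coef_w; rewrite (@coef_eq_mul _ w _ ('X^2 * residual u) N) //; last first.
  by move=> i iN; apply: coef_recop_seqpol => //; rewrite /N; nia.
have -> : w * ('X^2 * residual u) =
    'X^(p.+1) * (residual u * tp ^+ (p - 2) * qp ^+ half).
  have -> : p.+1 = (p.-1 + 2)%N by lia.
  by rewrite exprD /w; ring.
rewrite coefXnM ifF; last by apply/negbTE; rewrite -leqNgt; nia.
have <- // : (k * p + p.-1 = (k + 2) * p - p.+1)%N.
by rewrite mulnDl; lia.
Qed.

(** Termwise integration divides the coefficient of degree i by i + 1; this fails only if p divides
    i + 1, where the coefficient is 0. *)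
Lemma antiderivative (f : {poly F}) :
  (forall k, f`_(k * p + p.-1) = 0) -> exists g, f = g^`().
Proof.
move=> f0; have p0 := prime_gt0 p_pr.
exists (\poly_(i < (size f).+1) (f`_i.-1 / i%:R)).
apply/polyP => i; rewrite coef_deriv coef_poly ltnS /=.
have [pi|pi] := boolP (p %| i.+1)%N.
  have -> : f`_i = 0.
    case/dvdnP: pi => [[|k]] // iE.
    by have <- : (k * p + p.-1 = i)%N by rewrite mulSn in iE; lia.
  by rewrite mul0r if_same mul0rn.
case: ltnP => [_|hi]; last by rewrite nth_default // mul0rn.
by rewrite -[(_ / _) *+ _]mulr_natr divfK // -(dvdn_pcharf pcharFp).
Qed.

(** By the chain rule an affine substitution turns derivatives into derivatives, up to the factor
    c. *)
Lemma coef_comp_affine_eq0 (f : {poly F}) (c d : F) : c != 0 ->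
  (forall k, f`_(k * p + p.-1) = 0) ->
  forall k, (f \Po (c *: 'X + d%:P))`_(k * p + p.-1) = 0.
Proof.
move=> c0 /antiderivative [g ->] k; apply: (mulIf c0); rewrite mul0r.
have p0 := prime_gt0 p_pr.
have := congr1 (fun h : {poly F} => h`_(k * p + p.-1))
  (deriv_comp g (c *: 'X + d%:P)).
rewrite derivD derivC derivZ derivX addr0 alg_polyC coefMC => <-.
rewrite coef_deriv; have -> : (k * p + p.-1).+1 = (k.+1 * p)%N.
  by rewrite mulSn; lia.
by rewrite -mulr_natr natrM (pcharf0 pcharFp) !mulr0.
Qed.

Local Notation K := (kpol F half).

(** As its exponent acts as -1/2, K satisfies (x^2 - 2x + 65) K' = (1 - x) K; the coefficients of
    degree k + 1 are compared. *)
Lemma coef_K_rec k :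
  k.+1%:R * K`_k - (2 * k + 3)%N%:R * K`_k.+1 + 65%:R * k.+2%:R * K`_k.+2 = 0.
Proof.
have EK : ('X^2 - 2%:R * 'X + 65%:R) * K^`() = K - K * 'X.
  rewrite /kpol mul_deriv_exp -/K !derivE.
  have := natrp_half pcharFp p_odd; set c := half%:R => c2.
  transitivity ((c *+ 2) * ('X - 1) * K); first ring.
  by rewrite c2; ring.
have := congr1 (fun h : {poly F} => h`_k.+1) EK.
have -> : ('X^2 - 2%:R * 'X + 65%:R) * K^`() =
  K^`() * 'X * 'X - (K^`() * 'X) *+ 2 + K^`() *+ 65 by ring.
rewrite !(coefD, coefN, coefMn, coefMX, coef_deriv).
case: k => [|k]; rewrite ?coef_deriv /= => /eqP; rewrite -subr_eq0 => /eqP E.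
  by rewrite -[RHS]E; ring.
by rewrite -[RHS]E; ring.
Qed.

Hypothesis nz65 : 65%:R != 0 :> F.

Lemma coef0_K : K`_0 != 0.
Proof.
rewrite -horner_coef0 horner_exp expf_neq0 //.
have -> : 'X^2 - 2%:R * 'X + 65%:R = ('X - 2%:R) * 'X + 65%:R%:P :> {poly F}.
  by rewrite polyC_natr; ring.
by rewrite hornerD hornerM hornerX hornerC mulr0 add0r.
Qed.

(** By [coef_K_rec], two consecutive zeros propagate down to K_0, because k + 1 is invertible for k
    + 1 < p. *)
Lemma coef_K_neq0 : ~~ [&& K`_half == 0 & K`_half.+1 == 0].
Proof.
suff H k : (k < p)%N -> K`_k = 0 -> K`_k.+1 = 0 -> K`_0 = 0.
  apply/andP => -[/eqP K0 /eqP K1]; have /eqP := coef0_K; apply.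
  by apply: H K0 K1; lia.
elim: k => // k IH kp Kk Kk1; apply: IH => //; first exact: ltnW.
have /eqP := coef_K_rec k; rewrite Kk Kk1 !mulr0 subr0 addr0 mulf_eq0.
by rewrite -(dvdn_pcharf pcharFp) gtnNdvd //= => /eqP.
Qed.

(** After the substitution there remains a quadratic polynomial times the even K(x^2) times x^(p-2).
    Degree p-1, at the odd offset 1, isolates its linear coefficient times K_0; degree 2p-1, at the
    even offset p+1, isolates its constant and quadratic coefficients. *)
Lemma residual_relations (u : nat -> F) : recurrence u ->
  6%:R * u 4%N + u 2%N + u 1%N = 0 /\
  (4%:R * (residual u)`_0 - (residual u)`_1) * K`_half.+1
    + (residual u)`_1 * K`_half = 0.
Proof.
move=> ru.
have nz2 : 2%:R != 0 :> F.
  by rewrite -(dvdn_pcharf pcharFp) gtnNdvd.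
set r2 := (residual u)`_0; set r3 := (residual u)`_1.
pose r4 := (residual u)`_2.
have rE : residual u = r2%:P + r3%:P * 'X + r4%:P * 'X^2.
  rewrite /r2 /r3 /r4 /residual !(coefD, coefCM, coefXn, coefX, coefC) /=.
  by rewrite !(mulr0, mulr1, addr0, add0r).
pose l : {poly F} := 2%:R^-1 *: 'X + (- 2%:R^-1)%:P.
have H k : (((4%:R * r2 - 2%:R * r3 + r4)%:P + (2%:R * (r3 - r4))%:P * 'X
    + r4%:P * 'X^2) * (K \Po 'X^2) * 'X^(p - 2))`_(k * p + p.-1) = 0.
  set M : {poly F} := (X in polyseq X).
  (* The factor 4 clears the denominators of the residual at (x-1)/2, the power of 16 those of the
     power of q. *)
  have -> : M = (4%:R * 16%:R ^+ half)%:P *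
      ((residual u * tp ^+ (p - 2) * qp ^+ half) \Po l).
    have l2 : 2%:R * l = 'X - 1.
      rewrite /l -mul_polyC -polyC_natr mulrDr mulrA -!polyCM mulfV // mul1r.
      by rewrite mulrN mulfV // polyCN.
    have tl : tp \Po l = 'X.
      rewrite /tpol rmorphD rmorphM rmorph_nat rmorph1 /= comp_polyX.
      by rewrite l2 subrK.
    have ql : 16%:R * (qp \Po l) = ('X^2 - 2%:R * 'X + 65%:R) \Po 'X^2.
      rewrite /qpol /spol !(rmorphD, rmorphN, rmorphM, rmorphXn, rmorph_nat) /=.
      rewrite !comp_polyX.
      transitivity (((2%:R * l) ^+ 2 + 2%:R * (2%:R * l)) ^+ 2 + 64%:R).
        by ring.
      by rewrite l2; ring.
    have rl : 4%:R * (residual u \Po l) = (4%:R * r2 - 2%:R * r3 + r4)%:P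
        + (2%:R * (r3 - r4))%:P * 'X + r4%:P * 'X^2.
      rewrite rE !(rmorphD, rmorphN, rmorphM, rmorphXn) /=.
      rewrite !comp_polyX !comp_polyC ?polyC_natr.
      transitivity (4%:R * r2%:P + 2%:R * r3%:P * (2%:R * l)
        + r4%:P * (2%:R * l) ^+ 2); first ring.
      by rewrite l2; ring.
    rewrite /M -rl /kpol rmorphXn /= -ql !rmorphM !rmorphXn /= tl exprMn.
    by rewrite !polyC_natr; ring.
  rewrite coefCM coef_comp_affine_eq0 ?mulr0 ?invr_eq0 //.
  by move=> j; apply: coef_residual_eq0.
have coefM3 (a b d : F) (E : {poly F}) n :
    ((a%:P + b%:P * 'X + d%:P * 'X^2) * E)`_n =
    a * E`_n + (if n is n'.+1 then b * E`_n' else 0)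
    + (if n is n'.+2 then d * E`_n' else 0).
  rewrite !mulrDl -!mulrA !coefD !coefCM !coefXM.
  by case: n => [|[|n]] /=; rewrite ?mulr0.
have E1 := H 0%N; have E2 := H 1%N; move: E1 E2 {H}.
have -> : (0 * p + p.-1 = (p - 2) + 1)%N by lia.
have -> : (1 * p + p.-1 = (p - 2) + p.+1)%N by lia.
rewrite !coefMXn !ltnNge !leq_addr /= !addKn !coefM3.
rewrite !(@coef_comp_poly_Xn _ K 2) //=.
have -> : (2 %| p)%N = false by rewrite dvdn2 p_odd.
have -> : (2 %| p.+1)%N by rewrite dvdn2 /= p_odd.
have -> : (p.+1 %/ 2 = half.+1)%N by rewrite divn2; lia.
have mE (f : nat -> F) : (if p is n.+1 then f n else 0) = f p.-1.
  by move: p_gt2; case: (p).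
rewrite (mE (fun n => r4 * (K \Po 'X^2)`_n)) coef_comp_poly_Xn //.
have -> : (2 %| p.-1)%N by rewrite dvdn2; lia.
rewrite div0n divn2 !mulr0 !addr0 add0r => /eqP.
rewrite !mulf_eq0 (negPf nz2) (negPf coef0_K) orbF /= subr_eq0 => /eqP r34 E2.
split; last first.
  by rewrite -[RHS]E2 -r34; ring.
(* The difference r3 - r4 is -2 times the linear form of the first relation. *)
apply: (mulfI nz2); rewrite mulr0; apply/eqP; rewrite -oppr_eq0; apply/eqP.
transitivity (r3 - r4); last by rewrite r34 subrr.
rewrite /r3 /r4 /residual !(coefD, coefCM, coefXn, coefX, coefC) /=.
ring.
Qed.

End Functional.

(** * No nonzero polynomial solutions of degree at most p *)

Section PolynomialSolutions.
Variables (F : fieldType) (p : nat).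
Hypotheses (pcharFp : p \in [pchar F]) (p_odd : odd p).
Hypothesis nz65 : 65%:R != 0 :> F.

Local Notation tp := (tpol F).
Local Notation sp := (spol F).
Local Notation qp := (qpol F).
Local Notation half := (p.-1./2).

Let p_pr : prime p := pcharf_prime pcharFp.

Lemma scale_polyC_inv (n : nat) : n%:R != 0 :> F ->
  (n%:R^-1)%:P * n%:R = 1 :> {poly F}.
Proof. by move=> n0; rewrite -polyC_natr -polyCM mulVf. Qed.

(** Modulo s, q is 4, and x divides s; modulo t, 16 q = t^4 - 2 t^2 + 65 is 65. *)
Lemma coprimep_qpol : coprimep qp ('X * sp * tp ^+ 2).
Proof.
have nz4 : 4%:R != 0 :> F.
  rewrite (natrM _ 2 2) mulf_neq0 // -(dvdn_pcharf pcharFp) gtnNdvd //.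
    by have := prime_gt1 p_pr; lia.
  by have := prime_gt1 p_pr; lia.
have cqs : coprimep qp sp.
  apply/Bezout_eq1_coprimepP.
  exists ((4%:R^-1)%:P, - (4%:R^-1)%:P * sp) => /=.
  by rewrite -[RHS](scale_polyC_inv nz4) /qpol; ring.
have cqX : coprimep qp 'X.
  move: cqs; have -> : sp = 'X * ('X + 1) by rewrite /spol; ring.
  by rewrite coprimepMr => /andP[].
have cqt : coprimep qp tp.
  apply/Bezout_eq1_coprimepP.
  exists ((65%:R^-1)%:P * 16%:R, - (65%:R^-1)%:P * tp * (tp ^+ 2 - 2%:R)) => /=.
  by rewrite -[RHS](scale_polyC_inv nz65) /qpol /spol /tpol; ring.
by rewrite !coprimepMr cqX cqs cqt.
Qed.

(** Induction on j: for y = U q^j, the identity Q = (4x + 1) q - x s t^2 shows that q divides (2j+1)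
    x s t^2 U. Here 2j + 1 < p is invertible and x s t^2 is coprime to q. *)
Lemma qpol_exp_dvd (Y : {poly F}) j : recop Y = 0 -> (j <= half)%N ->
  qp ^+ j %| Y.
Proof.
move=> LY; elim: j => [|j IH] jh; first by rewrite expr0 dvd1p.
have /dvdpP [U YE] := IH (ltnW jh).
have q0 : qp != 0.
  by have := size_qpol_exp F 1; rewrite expr1 -size_poly_eq0 => ->.
have qU : qp %| U.
  have qdvd : qp %| (2 * j + 1)%N%:R%:P * ('X * sp * tp ^+ 2) * U.
    apply/dvdpP; exists ((4%:R * 'X + 1) * U - tp * 'X * U^`()).
    apply: (mulfI (expf_neq0 j q0)); apply/eqP; rewrite -subr_eq0; apply/eqP.
    rewrite -[RHS]LY YE /recop derivM.
    have := mul_deriv_exp qp j; rewrite deriv_qpol.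
    set h := qp ^+ j; set h' := h^`() => E.
    have -> : tp * qp * ('X * (U^`() * h + U * h')) =
      tp * 'X * (qp * U^`() * h + U * (qp * h')) by ring.
    by rewrite E polyC_natr /Qpol /qpol /spol /tpol; ring.
  move: qdvd; rewrite -mulrA -mulrCA mulrC.
  rewrite Gauss_dvdpl ?coprimep_qpol //.
  rewrite mul_polyC dvdpZr // -(dvdn_pcharf pcharFp) gtnNdvd //; lia.
by rewrite exprS YE dvdp_mul2r ?expf_neq0.
Qed.

(** The degree 2p - 2 of q^((p-1)/2) exceeds p, as p is at least 3. *)
Lemma recop_small_eq0 (Y : {poly F}) :
  recop Y = 0 -> (size Y <= p.+1)%N -> Y = 0.
Proof.
move=> LY sY; apply/eqP; apply: contraTT sY => Y0; rewrite -ltnNge.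
have := dvdp_leq Y0 (qpol_exp_dvd LY (leqnn half)).
rewrite size_qpol_exp; apply: leq_trans.
have := prime_gt1 p_pr; lia.
Qed.

End PolynomialSolutions.

(** * The binomial series for c and its reduction *)

(* (1 + s^2 / 4)^(-1/2) is the sum of the binom_coef k s^(2k). *)
Definition binom_coef (k : nat) : rat :=
  (-1) ^+ k * 'C(2 * k, k)%:R / 16%:R ^+ k.

Lemma binom_coefS k :
  8%:R * k.+1%:R * binom_coef k.+1 = - ((2 * k + 1)%N%:R * binom_coef k).
Proof.
have E : (k.+1 * 'C(2 * k.+1, k.+1) = 2 * (2 * k + 1) * 'C(2 * k, k))%N.
  apply/eqP; rewrite -(eqn_pmul2l (ltn0Sn k)); apply/eqP.
  have -> : (2 * k.+1 = (2 * k).+2)%N by lia.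
  have := mul_bin_diag (2 * k).+2 k; have := mul_bin_down (2 * k).+1 k.
  rewrite /=; nia.
have n16 : 16%:R ^+ k != 0 :> rat by rewrite expf_neq0.
have ER : k.+1%:R * 'C(2 * k.+1, k.+1)%:R
    = (2 * (2 * k + 1))%N%:R * 'C(2 * k, k)%:R :> rat.
  by rewrite -!natrM E.
rewrite /binom_coef !exprS.
transitivity (- (8%:R * ((-1) ^+ k * (k.+1%:R * 'C(2 * k.+1, k.+1)%:R)
  / 16%:R ^+ k) / 16%:R) : rat).
  by field.
by rewrite ER; field.
Qed.

(** A truncation of 2 x t q^(-1/2) = x t (1 + s^2/4)^(-1/2). *)
Definition ypol (N : nat) : {poly rat} :=
  'X * tpol _ * \sum_(k < N.+1) (binom_coef k)%:P * spol _ ^+ (2 * k).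

(** For the truncated series S, L (x t S) = x^2 t^2 (q S' + s t S), and the bracket telescopes to a
    single multiple of s^(2N+1), where x divides s. *)
Lemma recop_ypol N : exists g, recop (ypol N) = 'X^(2 * N) * g.
Proof.
set S := \sum_(k < N.+1) (binom_coef k)%:P * spol _ ^+ (2 * k).
have ES : qpol _ * S^`() + spol _ * tpol _ * S =
    (2 * N + 1)%N%:R * (binom_coef N)%:P * tpol _ * spol _ ^+ (2 * N).+1.
  rewrite /S; elim: N {S} => [|N IH].
    rewrite big_ord1 !muln0 expr0 mulr1 derivC; ring.
  rewrite big_ord_recr /= derivD.
  set A := \sum_(k < _) _ in IH *.
  set b := (binom_coef N.+1)%:P.
  have -> : (b * spol _ ^+ (2 * N.+1))^`() =
     (2 * N.+1)%N%:R * b * tpol _ * spol _ ^+ (2 * N).+1.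
    rewrite derivM derivC deriv_exp deriv_spol mul0r add0r.
    have -> : (2 * N.+1).-1 = (2 * N).+1 by lia.
    by ring.
  transitivity ((qpol _ * A^`() + spol _ * tpol _ * A) +
    ((2 * N.+1)%N%:R * b * tpol _ * spol _ ^+ (2 * N).+1 * qpol _
     + spol _ * tpol _ * b * spol _ ^+ (2 * N.+1))); first ring.
  rewrite IH.
  (* The constant 4 in q makes the derivative of the new term cancel the previous defect. *)
  have Eb : 8%:R * N.+1%:R * b = - ((2 * N + 1)%N%:R * (binom_coef N)%:P).
    by rewrite -!polyC_natr -!polyCM binom_coefS polyCN.
  have -> : (2 * N + 1)%N%:R * (binom_coef N)%:P = - (8%:R * N.+1%:R * b).
    by rewrite Eb opprK.
  have -> : (2 * N.+1 = (2 * N).+2)%N by lia.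
  rewrite !exprS /qpol; ring.
exists ('X ^+ 3 * ('X + 1) ^+ (2 * N).+1 * tpol _ ^+ 3
  * (2 * N + 1)%N%:R * (binom_coef N)%:P).
have -> : recop (ypol N) =
    'X^2 * tpol _ ^+ 2 * (qpol _ * S^`() + spol _ * tpol _ * S).
  rewrite /recop /ypol -/S !derivM derivX deriv_tpol /Qpol /qpol /spol /tpol.
  ring.
rewrite ES; have -> : spol rat = 'X * ('X + 1) by rewrite /spol; ring.
rewrite exprMn ![_ ^+ (2 * N).+1]exprS; ring.
Qed.

(** Degrees 2, 3 and 4 of L y = 0 force the initial values 2, -1/8 and -1/2; from degree 5 on the
    equation is the recurrence. *)
Lemma coef_c_spec (u : nat -> rat) (Y : {poly rat}) M :
  c_spec u -> Y`_0 = 0 -> Y`_1 = 1 ->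
  (forall m, (m < M)%N -> (recop Y)`_m = 0) ->
  forall n, (n < M)%N -> Y`_n = u n.
Proof.
move=> [ru c0 c1 c2 [c3 c4]] y0 y1 L0 n nN.
have [_ _ L2 L3 L4] := coef_recop_low y0.
elim/ltn_ind: n nN => -[|[|[|[|[|n]]]]] IH nN.
- by rewrite y0 c0.
- by rewrite y1 c1.
- move: L2; rewrite L0 // y1 c2 => /esym/eqP.
  rewrite subr_eq0 => /eqP E.
  have n4 : 4%:R != 0 :> rat by [].
  by apply: (mulfI n4); rewrite E; ring.
- move: L3; rewrite L0 // y1 c3 => /esym/eqP.
  rewrite addr_eq0 => /eqP E.
  have n4 : 8%:R != 0 :> rat by [].
  by apply: (mulfI n4); rewrite E; field.
- move: L4; rewrite L0 // y1 c4.
  rewrite (IH 2) ?(IH 3) //; try lia.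
  rewrite c2 c3 => /esym/eqP.
  rewrite -!addrA addr_eq0 => /eqP E.
  have n4 : 12%:R != 0 :> rat by [].
  by apply: (mulfI n4); rewrite E; field.
have := coef_recop Y n; rewrite L0 //.
have n4 : (4 * (n + 4))%N%:R != 0 :> rat.
  by rewrite pnatr_eq0 muln_eq0 addn_eq0 andbF.
have := ru n.
rewrite !(IH n, IH (n + 1)%N, IH (n + 2)%N, IH (n + 3)%N, IH (n + 4)%N);
  try lia.
move=> E /esym E'; apply: (mulfI n4).
have -> : n.+4.+1 = (n + 5)%N by lia.
move: E'; rewrite -E => /addIr/addIr/addIr/addIr/addIr; apply.
Qed.

Lemma coef_ypol N n : (n < 2 * N)%N -> (ypol N)`_n = c n.
Proof.
have [g Lg] := recop_ypol N.
apply: coef_c_spec; first exact/c_specP; first by rewrite /ypol -mulrA coefXM.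
  rewrite /ypol -mulrA coefXM /= -horner_coef0 hornerM horner_sum.
  have s0 : (spol rat).[0] = 0.
    by rewrite horner_coef0 /spol coefD coefXn coefX addr0.
  have t0 : (tpol rat).[0] = 1.
    rewrite horner_coef0 /tpol mulr_natl coefD coefMn coefX coef1.
    by rewrite mul0rn add0r.
  rewrite t0 mul1r big_ord_recl big1 => [|k _].
    rewrite muln0 expr0 mulr1 hornerC /binom_coef bin0 !expr0.
    by rewrite divr1 mulr1 addr0.
  by rewrite hornerM horner_exp s0 expr0n mulr0.
by move=> m mN; rewrite Lg coefXnM mN.
Qed.

(** The factor 16^N clears the denominators of all [binom_coef k] with k at most N at once. *)
Lemma c_dyadic N : exists E : {poly int}, forall n, (n < 2 * N)%N ->
  c n * (16 ^ N)%N%:~R = (E`_n)%:~R.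
Proof.
pose b k : int := (-1) ^+ k * 'C(2 * k, k)%:R * 16%:R ^+ (N - k).
pose E : {poly int} :=
  'X * tpol _ * \sum_(k < N.+1) (b k)%:P * spol _ ^+ (2 * k).
exists E => n nN; rewrite -(coef_ypol nN) mulrC -coefCM -coef_map /=.
congr (nth _ (polyseq _) _).
rewrite /E !rmorphM /= map_polyX rmorph_sum mulrCA; congr (_ * _ * _).
  by rewrite /tpol rmorphD rmorphM rmorph_nat rmorph1 /= map_polyX.
rewrite mulr_sumr; apply: eq_bigr => k _.
rewrite rmorphM rmorphXn /= map_polyC /= mulrA -polyCM; congr (_%:P * _ ^+ _).
  rewrite /b /binom_coef !rmorphM !rmorphXn /= rmorphN1 !rmorph_nat.
  have n16 : 16%:R ^+ k != 0 :> rat by rewrite expf_neq0.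
  have -> : (16 ^ N)%N%:~R = 16%:R ^+ (N - k) * 16%:R ^+ k :> rat.
    by rewrite -exprD subnK -?natrX // -ltnS.
  by field.
by rewrite /spol rmorphD rmorphXn /= map_polyX.
Qed.

(** [ratr] uses lowest terms, whose denominator divides d and so is nonzero in F too. *)
Lemma ratr_eq_div (F : fieldType) (x : rat) (a d : int) : d%:~R != 0 :> F ->
  x * d%:~R = a%:~R -> ratr x = a%:~R / d%:~R :> F.
Proof.
move=> d0 xd.
have E : numq x * d = a * denq x.
  apply: (@intr_inj rat); rewrite !intrM -xd -{2}[x]divq_num_den.
  by field; rewrite intr_eq0 denq_neq0.
have /dvdzP [e dE] : (denq x %| d)%Z.
  rewrite -(@Gauss_dvdzr (denq x) (numq x)); last first.
    by rewrite /coprimez gcdzC; exact: coprime_num_den.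
  by apply/dvdzP; exists a.
have den0 : (denq x)%:~R != 0 :> F.
  by apply: contraNneq d0 => den0; rewrite dE intrM den0 mulr0.
apply: (mulIf d0); rewrite divfK // /ratr mulrAC -intrM E intrM.
by rewrite mulfK.
Qed.

(** [ratr] need not be additive into F, so the values are put over the common denominator 16^N and
    the recurrence passes through the integer numerators. *)
Lemma recurrence_ratr_c (F : fieldType) : 2%:R != 0 :> F ->
  recurrence (fun n => ratr (c n) : F).
Proof.
move=> nz2 n; set N := (n + 6)%N; have [E cE] := c_dyadic N.
have d0 : (16 ^ N)%N%:~R != 0 :> F.
  by rewrite -pmulrn natrX expf_neq0 // (natrX _ 2 4) expf_neq0.
have rE m : (m <= n + 5)%N -> ratr (c m) = (E`_m)%:~R / (16 ^ N)%N%:~R :> F.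
  by move=> mn; apply: ratr_eq_div => //; apply: cE; rewrite /N; lia.
rewrite !rE; try lia.
have [ru _ _ _ _] := (c_specP c).2 erefl.
have Eint : (4 * (n + 4))%N%:R * E`_(n + 5) + (8 * (n + 2))%N%:R * E`_(n + 4)
    + (n + 3)%N%:R * E`_(n + 3) + (4 * n + 7)%N%:R * E`_(n + 2)
    + (5 * n + 4)%N%:R * E`_(n + 1) + (2 * n)%N%:R * E`_n = 0.
  apply: (@intr_inj rat); rewrite mulr0z !(intrD, intrM, mulrz_nat).
  rewrite -!cE; try by rewrite /N; lia.
  by rewrite !mulrA -!mulrDl ru mul0r.
rewrite !mulrA -!mulrDl.
have := congr1 (fun z : int => z%:~R : F) Eint.
by rewrite /= mulr0z !(intrD, intrM, mulrz_nat) => ->; rewrite mul0r.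
Qed.

(** * The shift by p and the spanning pair *)

Section Shift.
Variables (F : fieldType) (p : nat).
Hypotheses (pcharFp : p \in [pchar F]).

(** In F the coefficients of the recurrence depend on n only modulo p. *)
Lemma recurrence_shift (u : nat -> F) :
  recurrence u -> recurrence (fun n => u (n + p)%N).
Proof.
move=> ru n; have := ru (n + p)%N.
rewrite -!(addnA n p) !(addnC p) !addnA.
by rewrite !(natrM, natrD) !(pcharf0 pcharFp) !addr0.
Qed.

Hypotheses (p_odd : odd p) (nz65 : 65%:R != 0 :> F).

(* If the shift were a homogeneous solution too, then so would be the
   truncation of u at degree p. *)
Lemma residual_shift_neq0 (u : nat -> F) :
  recurrence u -> residual u = 0 -> u 1%N != 0 ->
  residual (fun n => u (n + p)%N) != 0.
Proof.
move=> ru resu u1; apply/eqP => resd.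
have p0 : (0 < p)%N by case: (p) p_odd.
set d := (fun n => _) in resd.
have rd : recurrence d by exact: recurrence_shift.
pose T := seqpol u p.+1.
(* [seqpol d 7] has constant coefficient 0, so [u p] survives as the coefficient of degree p. *)
have TE : T = seqpol u (p + 7) - 'X^(1 * p) * seqpol d 7.
  apply/polyP => m; rewrite coefB mul1n coefXnM !coef_poly.
  case: (ltnP m p) => mp; first by rewrite ltnS ltnW // ltn_addr // subr0.
  rewrite -(subnKC mp) addKn; set j := (m - p)%N.
  rewrite ltn_add2l; have -> : (p + j < p.+1)%N = (j == 0)%N by lia.
  case: j => [|j] /=; first by rewrite subr0.
  by rewrite addnS /d addSn [(j + p)%N]addnC; case: ltnP; rewrite subrr.
have LT : recop T = 0.
  apply/polyP => m; rewrite coef0.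
  (* The size of L T is at most p + 6. *)
  case: (ltnP m (p + 7)) => mN; last first.
    rewrite nth_default //; apply: leq_trans (size_recop _) _.
    have : (size T <= p.+1)%N by exact: size_poly.
    lia.
  rewrite TE recopB (recop_mulXpn pcharFp) coefB mul1n coefXnM.
  rewrite coef_recop_seqpol // ?resu ?mulr0 ?coef0; last by lia.
  case: ltnP => mp; first by rewrite subrr.
  rewrite coef_recop_seqpol // ?resd ?mulr0 ?coef0 ?subrr //.
  by lia.
have T0 : T = 0 by apply: (recop_small_eq0 pcharFp) => //; exact: size_poly.
by move: u1; have := congr1 (fun f : {poly F} => f`_1) T0;
  rewrite coef_poly coef0 ltnS p0 => ->; rewrite eqxx.
Qed.

Hypotheses (nz3 : 3%:R != 0 :> F).

Lemma coef_residual (u : nat -> F) :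
  [/\ (residual u)`_0 = 4%:R * u 2%N - 8%:R * u 1%N,
      (residual u)`_1 = 8%:R * u 3%N + u 1%N,
      (residual u)`_2
      = 12%:R * u 4%N + 8%:R * u 3%N + 2%:R * u 2%N + 3%:R * u 1%N &
      forall n, (residual u)`_n.+3 = 0].
Proof.
by split=> [|||n]; rewrite /residual !(coefD, coefCM, coefXn, coefX, coefC) /=
  ?(mulr0, mulr1, addr0, add0r).
Qed.

(* The residual lies on the line cut out by residual_relations, and together
   with u 1 it determines u 1, ..., u 4. *)
Lemma recurrence_span (u d w : nat -> F) :
  recurrence d -> recurrence w -> residual u = 0 -> u 1%N = 1 ->
  residual d != 0 -> exists a b, forall i, (0 < i <= 4)%N ->
    w i = a * u i + b * d i.
Proof.
move=> rd rw resu u1 resd.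
have p2 : 2%:R != 0 :> F.
  rewrite -(dvdn_pcharf pcharFp) gtnNdvd //.
  by have := prime_gt1 (pcharf_prime pcharFp); lia.
have [hd Kd] := residual_relations pcharFp p_odd nz65 rd.
have [hw Kw] := residual_relations pcharFp p_odd nz65 rw.
have [u2 u3 u4 _] := coef_residual u; rewrite resu !coef0 in u2 u3 u4.
have [d2 d3 d4 d5] := coef_residual d.
have [w2 w3 w4 _] := coef_residual w.
have := coef_K_neq0 pcharFp p_odd nz65; move: Kd Kw.
set K0 := (kpol _ _)`_p.-1./2.+1; set K1 := (kpol _ _)`_p.-1./2 => Kd Kw K01.
have h34 (v : nat -> F) : 6%:R * v 4%N + v 2%N + v 1%N = 0 ->
    (residual v)`_2 = (residual v)`_1.
  have [_ E3 E4 _] := coef_residual v; rewrite E3 E4 => h.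
  rewrite -[RHS]addr0 -(mulr0 2%:R) -h; ring.
have d34 := h34 _ hd; have w34 := h34 _ hw.
have [b [bw2 bw3]] : exists b, (residual w)`_0 = b * (residual d)`_0 /\
    (residual w)`_1 = b * (residual d)`_1.
  set x := (residual w)`_0 in Kw *; set y := (residual w)`_1 in Kw *.
  set X := (residual d)`_0 in Kd *; set Y := (residual d)`_1 in Kd *.
  have XY : ~~ [&& X == 0 & Y == 0].
    apply: contra resd => /andP [/eqP X0 /eqP Y0]; apply/eqP/polyP => n.
    rewrite coef0; case: n => [|[|[|n]]] //.
    by rewrite d34.
  (* [K0] and [K1] do not both vanish, so two vectors satisfying the same linear relation have
     determinant 0. *)
  have E : x * Y = X * y.
    have n4 : 4%:R != 0 :> F by rewrite (natrM _ 2 2) mulf_neq0.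
    apply: (mulfI n4); move: K01; rewrite negb_and => /orP [k|k].
      apply: (mulfI k); apply/eqP; rewrite -subr_eq0; apply/eqP.
      transitivity ((4%:R * x - y) * ((4%:R * X - Y) * K0 + Y * K1)
        - (4%:R * X - Y) * ((4%:R * x - y) * K0 + y * K1)); last first.
        by rewrite Kw Kd !mulr0 subrr.
      ring.
    apply: (mulfI k); apply/eqP; rewrite -subr_eq0; apply/eqP.
    transitivity (Y * ((4%:R * x - y) * K0 + y * K1)
      - y * ((4%:R * X - Y) * K0 + Y * K1)); last first.
      by rewrite Kw Kd !mulr0 subrr.
    ring.
  have [Y0|Y0] := eqVneq Y 0; last first.
    by exists (y / Y); rewrite mulrAC [y * X]mulrC -E mulfK // divfK.
  move: XY; rewrite Y0 eqxx andbT => X0.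
  exists (x / X); rewrite divfK // mulr0; split=> //.
  by move/esym/eqP: E; rewrite Y0 mulr0 mulf_eq0 (negPf X0) => /eqP.
(* The first coefficient is forced by index 1, where u is 1. *)
exists (w 1%N - b * d 1%N), b.
have n4 : 4%:R != 0 :> F by rewrite (natrM _ 2 2) mulf_neq0.
have n8 : 8%:R != 0 :> F by rewrite (natrM _ 2 4) mulf_neq0.
have n12 : 12%:R != 0 :> F by rewrite (natrM _ 3 4) mulf_neq0.
have e1 : w 1%N = (w 1%N - b * d 1%N) * u 1%N + b * d 1%N by rewrite u1; ring.
move: w34; rewrite w4 => w34.
move: bw2 bw3 d34; rewrite w2 w3 d2 d3 d4 => bw2 bw3 d34.
rewrite w3 in w34.
set a := w 1%N - _ in e1 *.
(* The residual is triangular in the entries 2, 3, 4, with pivots 4, 8, 12; as e vanishes at 1 and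
   has residual 0, it vanishes at all four indices. *)
pose e i := w i - (a * u i + b * d i).
have E1 : e 1%N = 0 by rewrite /e -e1 subrr.
have E2 : e 2%N = 0.
  apply: (mulfI n4).
  transitivity ((4%:R * w 2%N - 8%:R * w 1%N
      - b * (4%:R * d 2%N - 8%:R * d 1%N)) + 8%:R * e 1%N
    - a * (4%:R * u 2%N - 8%:R * u 1%N)); first by rewrite /e; ring.
  by rewrite E1 bw2 -u2; ring.
have E3 : e 3%N = 0.
  apply: (mulfI n8).
  transitivity ((8%:R * w 3%N + w 1%N - b * (8%:R * d 3%N + d 1%N)) - e 1%N
    - a * (8%:R * u 3%N + u 1%N)); first by rewrite /e; ring.
  by rewrite E1 bw3 -u3; ring.
have E4 : e 4%N = 0.
  apply: (mulfI n12).
  pose l (v : nat -> F) :=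
    12%:R * v 4%N + 8%:R * v 3%N + 2%:R * v 2%N + 3%:R * v 1%N.
  transitivity (l w - b * l d - a * l u
    - 8%:R * e 3%N - 2%:R * e 2%N - 3%:R * e 1%N); first by rewrite /e /l; ring.
  by rewrite /l E1 E2 E3 w34 d34 bw3 -u4; ring.
move=> i i4; apply/eqP; rewrite -subr_eq0; apply/eqP.
by case: i i4 => [|[|[|[|[|i]]]]].
Qed.

End Shift.

(** * Reduction of the initial values and assembly of the theorem *)

Definition red_c (p n : nat) : 'F_p := ratr (c n).

Lemma coords14_red_c (p k : nat) :
  coords14 (fun n => red_c p (n + k) : ('F_p)^o) =
  red p (row4 (c (k + 1)) (c (k + 2)) (c (k + 3)) (c (k + 4))).
Proof.
apply/rowP => i; rewrite !mxE /red_c.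
rewrite (addnC k 1) (addnC k 2) (addnC k 3) (addnC k 4).
by case: i => [[|[|[|[|i]]]] hi] //; rewrite (tnth_nth 0).
Qed.

Lemma residual_init (F : fieldType) (u : nat -> F) : 2%:R != 0 :> F ->
  u 1%N = 1 -> u 2%N = 2%:R -> u 3%N = - (1 / 8%:R) -> u 4%N = - (1 / 2%:R) ->
  residual u = 0.
Proof.
move=> n2 u1 u2 u3 u4; rewrite /residual u1 u2 u3 u4.
have n8 : 8%:R != 0 :> F by rewrite (natrM _ 2 4) (natrM _ 2 2) !mulf_neq0.
have -> : 4%:R * 2%:R - 8%:R * 1 = 0 :> F by ring.
have E8 : 8%:R * - (1 / 8%:R) = -1 :> F by rewrite mulrN mul1r mulfV.
have -> : 8%:R * - (1 / 8%:R) + 1 = 0 :> F by rewrite E8 addNr.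
have -> : 12%:R * - (1 / 2%:R) + 8%:R * - (1 / 8%:R) + 2%:R * 2%:R + 3%:R * 1
    = 0 :> F.
  rewrite E8 (natrM _ 6 2) -mulrA mulrN mul1r mulfV //; ring.
by rewrite !mul0r !addr0.
Qed.

Lemma ratr_opp_inv (F : fieldType) (m : nat) : m%:R != 0 :> F ->
  ratr (- (1 / m%:R)) = - (1 / m%:R) :> F.
Proof.
move=> m0; rewrite (@ratr_eq_div _ _ (-1) m) //; first by rewrite mulrN1z mulNr.
have mQ : m%:R != 0 :> rat.
  by apply: contraNneq m0 => /eqP; rewrite pnatr_eq0 => /eqP ->.
by rewrite mulNr mul1r mulVf.
Qed.

Lemma residual_c_spec (F : fieldType) (u : nat -> rat) : 2%:R != 0 :> F ->
  c_spec u -> residual (fun n => ratr (u n) : F) = 0.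
Proof.
move=> n2 [_ _ u1 u2 [u3 u4]]; apply: residual_init => //.
- by rewrite u1 (ratr_nat _ 1).
- by rewrite u2 ratr_nat.
- by rewrite u3 ratr_opp_inv // (natrM _ 2 4) (natrM _ 2 2) !mulf_neq0.
- by rewrite u4 ratr_opp_inv.
Qed.

Lemma row4_c_spec (u : nat -> rat) : c_spec u ->
  row4 1 2 (- (1 / 8)) (- (1 / 2)) = row4 (u 1) (u 2) (u 3) (u 4).
Proof. by move=> [_ _ -> -> [-> ->]]. Qed.

Theorem theorem1p4 (p : nat) (p_prime : prime p) :
  ~ finite_dimensional (W p) /\
  (p \notin [:: 2; 3; 5; 13]%N ->
   [/\ \dim (V p) = 2%N,
       forall C1 C2 C3 C4 : 'F_p, row4 C1 C2 C3 C4 \in V p ->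
         6 * C4 + C2 + C1 = 0
     & V p = <<[:: red p (row4 1 2 (- (1 / 8)) (- (1 / 2)));
                   red p (row4 (c (p + 1)) (c (p + 2))
                               (c (p + 3)) (c (p + 4)))]>>%VS]).
Proof.
split=> [|hp]; first exact: not_finite_dimensional_W.
have pcharp : p \in [pchar 'F_p] by exact: pchar_Fp.
have [p2 p3 p5 p13] : [/\ p != 2, p != 3, p != 5 & p != 13]%N.
  by move: hp; rewrite !inE !negb_or => /and4P.
have natr_neq0 q : prime q -> p != q -> q%:R != 0 :> 'F_p.
  by move=> q_pr pq; rewrite -(dvdn_pcharf pcharp) dvdn_prime2.
have nz2 := natr_neq0 2 isT p2; have nz3 := natr_neq0 3 isT p3.
(* The exclusion of 5 and 13 enters through 65 = 5 * 13. *)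
have nz65 : 65%:R != 0 :> 'F_p.
  by rewrite (natrM _ 5 13) mulf_neq0 // natr_neq0.
have p_odd : odd p by case: (even_prime p_prime) p2 => // ->.
have rc := recurrence_ratr_c nz2.
have rd := recurrence_shift pcharp rc.
have cP : c_spec c by exact/c_specP.
have resu : residual (red_c p) = 0 by exact: residual_c_spec.
have u1 : red_c p 1 = 1.
  by case: cP => _ _ c1 _ _; rewrite /red_c c1 (ratr_nat _ 1).
have resd : residual (fun n => red_c p (n + p)) != 0.
  by apply: residual_shift_neq0 => //; rewrite u1 oner_eq0.
set u := red p (row4 1 _ _ _); set d := red p (row4 (c (p + 1)) _ _ _).
have uE : coords14 (red_c p : nat -> ('F_p)^o) = u.
  rewrite /u (row4_c_spec cP); have := coords14_red_c p 0; rewrite !add0n => <-.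
  by apply/rowP => i; rewrite !mxE addn0.
have dE : coords14 (fun n => red_c p (n + p) : ('F_p)^o) = d.
  exact: coords14_red_c.
have VE : V p = <<[:: u; d]>>%VS.
  apply/eqP; rewrite eqEsubv; apply/andP; split; last first.
    apply/span_subvP => v; rewrite !inE => /orP [] /eqP ->; apply/V_P.
      by exists (red_c p).
    by exists (fun n => red_c p (n + p)).
  apply/subvP => v /V_P [w ww <-].
  have [a [b wE]] := recurrence_span pcharp p_odd nz65 nz3 rd ww resu u1 resd.
  have -> : coords14 w = a *: u + b *: d.
    by rewrite -uE -dE; apply/rowP => i; rewrite !mxE wE //= ltn_ord.
  by rewrite memvD // memvZ // memv_span // !inE eqxx ?orbT.
split=> //.
  (* [free] unfolds to the equality of the dimension of the span with the number of generators. *)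
  rewrite VE; apply/eqP; change (free [:: u; d]).
  rewrite (perm_free (Y := [:: d; u])); last first.
    by rewrite (perm_catC [:: u] [:: d]).
  rewrite free_cons seq1_free span_seq1; apply/andP; split; last first.
    apply/eqP => /rowP /(_ 0); rewrite -uE !mxE u1 => /eqP.
    by rewrite oner_eq0.
  (* A multiple of u would have residual 0, unlike d. *)
  apply/negP => /vlineP [k]; rewrite -dE -uE => /rowP E.
  have : residual (fun n => red_c p (n + p)) = 0.
    have e i : (0 < i <= 4)%N -> red_c p (i + p) = k * red_c p i.
      case: i => // i /= i4; have := E (Ordinal i4); rewrite !mxE; exact.
    have -> : residual (fun n => red_c p (n + p)) = k%:P * residual (red_c p).
      by rewrite /residual !e //; ring.
    by rewrite resu mulr0.
  exact/eqP.
move=> C1 C2 C3 C4 /V_P [w ww /rowP wE].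
have [h _] := residual_relations pcharp p_odd nz65 ww.
have := wE 0; have := wE 1; have := wE (inord 3); rewrite !mxE !inordK //.
rewrite !(tnth_nth 0) !inordK //= => <- <- <-.
exact: h.
Qed.
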